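(* Let $p$ be a prime with $p\equiv\pm1\pmod 8$, let $\mathcal{D}_i,\mathcal{E}_i$ ($i=1,2$) be the quadratic residue codes of length $p$ over $R$ defined below, let $G_i$ be a generator matrix of $\mathcal{E}_i$, and let $\widehat{\mathcal{D}}_i,\widetilde{\mathcal{D}}_i$ be the extended codes of length $p+1$ defined below. Then: (i) if $p\equiv-1\pmod 8$, then $\widehat{\mathcal{D}}_i$ and $\widetilde{\mathcal{D}}_i$ are Euclidean self-dual for $i=1,2$; (ii) if $p\equiv1\pmod 8$, then $\widehat{\mathcal{D}}_1^\perp=\widetilde{\mathcal{D}}_2$ and $\widehat{\mathcal{D}}_2^\perp=\widetilde{\mathcal{D}}_1$.
   Context: $R=\mathbb{Z}_4[v]/(v^2-v)$, $R_p=R[X]/(X^p-1)$, vectors of $R^p$ identified with elements of $R_p$; $(f)$ denotes the ideal (cyclic code) generated by $f$. $\mathcal{Q}_p$ = nonzero quadratic residues mod $p$, $\mathcal{N}_p$ = quadratic non-residues; $Q(X)=\sum_{i\in\mathcal{Q}_p}X^i$, $N(X)=\sum_{i\in\mathcal{N}_p}X^i$. Case I ($p\equiv-1\pmod 8$, $p+1=8r$): if $r$ odd, $\mathcal{D}_1=(v(Q+2N)+(1-v)(N+2Q))$, $\mathcal{D}_2=(v(N+2Q)+(1-v)(Q+2N))$, $\mathcal{E}_1=(v(1-N+2Q)+(1-v)(1-Q+2N))$, $\mathcal{E}_2=(v(1-Q+2N)+(1-v)(1-N+2Q))$; if $r$ even, $\mathcal{D}_1=(-vQ-(1-v)N)$,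 $\mathcal{D}_2=(-vN-(1-v)Q)$, $\mathcal{E}_1=(v(1+N)+(1-v)(1+Q))$, $\mathcal{E}_2=(v(1+Q)+(1-v)(1+N))$. Case II ($p\equiv1\pmod 8$, $p-1=8r$): if $r$ odd, $\mathcal{D}_1=(v(1-N+2Q)+(1-v)(1-Q+2N))$, $\mathcal{D}_2=(v(1-Q+2N)+(1-v)(1-N+2Q))$, $\mathcal{E}_1=(v(Q+2N)+(1-v)(N+2Q))$, $\mathcal{E}_2=(v(N+2Q)+(1-v)(Q+2N))$; if $r$ even, $\mathcal{D}_1=(v(1+N)+(1-v)(1+Q))$, $\mathcal{D}_2=(v(1+Q)+(1-v)(1+N))$, $\mathcal{E}_1=(-vQ-(1-v)N)$, $\mathcal{E}_2=(-vN-(1-v)Q)$. A generator matrix $G_i$ of $\mathcal{E}_i$ is a matrix over $R$ whose rows generate $\mathcal{E}_i$ as an $R$-module. The extended codes: $\widehat{\mathcal{D}}_i$ (resp. $\widetilde{\mathcal{D}}_i$) is the $R$-linear code of length $p+1$ generated by the rows of the matrix whose first row is $(x,y,\dots,y)$ and whose remaining rows are $(0\mid \mathbf{g})$ for the rows $\mathbf{g}$ of $G_i$, where for $p\equiv-1\pmod 8$: $(x,y)=(3,3)$ for $\widehat{\mathcal{D}}_i$ and $(x,y)=(1,3)$ for $\widetilde{\mathcal{D}}_i$; for $p\equiv1\pmod 8$: $(x,y)=(3,1)$ for $\widehat{\mathcal{D}}_i$ and $(x,y)=(1,1)$ for $\widetilde{\mathcal{D}}_i$. Euclidean dual $\mathcal{C}^\perp=\{\mathbf{x}:\sum_ix_ic_i=0\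 \forall\mathbf{c}\in\mathcal{C}\}$; self-dual means $\mathcal{C}=\mathcal{C}^\perp$. *)

(* Defs.v *)
From HB Require Import structures.
From mathcomp Require Import all_boot all_order all_algebra.
Set Implicit Arguments. Unset Strict Implicit. Unset Printing Implicit Defensive.
Import GRing.Theory.
Local Open Scope ring_scope.

Definition Rv := {poly %/ ('X^2 - 'X : {poly 'Z_4})}.
Definition vR : Rv := 'qX.

Definition Rp (p : nat) := {poly %/ ('X^p - 1 : {poly Rv})}.

Definition is_qr (p i : nat) : bool :=
  [&& (0 < i)%N, (i < p)%N & [exists j : 'I_p, ((j * j) %% p == i)%N]].
Definition is_nqr (p i : nat) : bool :=
  [&& (0 < i)%N, (i < p)%N & ~~ [exists j : 'I_p, ((j * j) %% p == i)%N]].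

Definition Qp (p : nat) : Rp p := \sum_(i < p | is_qr p i) 'qX ^+ i.
Definition Np (p : nat) : Rp p := \sum_(i < p | is_nqr p i) 'qX ^+ i.

Definition E1gen (p : nat) : Rp p :=
  let Q := Qp p in let N := Np p in let v := vR in
  if (p %% 8 == 7)%N then
    (if odd ((p + 1) %/ 8) then v *: (1 - N + 2%:R * Q) + (1 - v) *: (1 - Q + 2%:R * N)
     else v *: (1 + N) + (1 - v) *: (1 + Q))
  else
    (if odd ((p - 1) %/ 8) then v *: (Q + 2%:R * N) + (1 - v) *: (N + 2%:R * Q)
     else - (v *: Q) - (1 - v) *: N).

Definition E2gen (p : nat) : Rp p :=
  let Q := Qp p in let N := Np p in let v := vR in
  if (p %% 8 == 7)%N then
    (if odd ((p + 1) %/ 8) then v *: (1 - Q + 2%:R * N) + (1 - v) *: (1 - N + 2%:R * Q)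
     else v *: (1 + Q) + (1 - v) *: (1 + N))
  else
    (if odd ((p - 1) %/ 8) then v *: (N + 2%:R * Q) + (1 - v) *: (Q + 2%:R * N)
     else - (v *: N) - (1 - v) *: Q).

Definition code (n : nat) := 'rV[Rv]_n -> Prop.

Definition vec_of (p : nat) (g : Rp p) : 'rV[Rv]_p := \row_(i < p) (g : {poly Rv})`_i.

Definition cyclic_code (p : nat) (f : Rp p) : code p :=
  fun c => exists a : Rp p, c = vec_of (a * f).

Definition row_span (k n : nat) (G : 'M[Rv]_(k, n)) : code n :=
  fun c => exists u : 'rV[Rv]_k, c = u *m G.

Definition is_generator_matrix (n k : nat) (C : code n) (G : 'M[Rv]_(k, n)) : Prop :=
  forall c, C c <-> row_span G c.

Definition ext_code (p k : nat) (x y : Rv) (G : 'M[Rv]_(k, p)) : code (1 + p) :=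
  row_span (col_mx (\row_(j < 1 + p) (if (val j == 0)%N then x else y))
                   (row_mx (0 : 'M[Rv]_(k, 1)) G)).

Definition dual (n : nat) (C : code n) : code n :=
  fun x => forall c, C c -> \sum_(i < n) x 0 i * c 0 i = 0.

Definition code_eq (n : nat) (C D : code n) : Prop := forall x, C x <-> D x.

Definition self_dual (n : nat) (C : code n) : Prop := code_eq (dual C) C.

(* Main.v *)
(* Identify vectors with elements of R_p = R[X]/(X^p - 1) and let qrev be the
   involution X -> X^(-1).  The Euclidean form is <f, g> = constant coefficient
   of f * qrev g, so the dual of the ideal (e) is the annihilator of qrev e.

   The only arithmetic input is the product Q * N.  Its coefficient at X^k is
   the number of ways to write k as a residue plus a nonresidue; scaling k by a
   residue preserves these representations and scaling by a nonresidue swaps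
   the two summands, so Q * N = c0 + c1 (Q + N), and counting gives c0 and c1.
   Modulo 4 this yields, for J = 1 + Q + N and d = -1 or 1,
     E1 * E2 = 0,  E1 * J = E2 * J = 0,  1 = E1 + E2 + d J.
   For p = -1 mod 8 (resp. 1 mod 8), -1 is a nonresidue (residue), so qrev swaps
   (fixes) E1 and E2.  If f annihilates qrev e, multiplying the last identity by
   f writes f as an element of the other ideal plus a multiple of J, and pairing
   with the first row of the extended matrix determines the extra coordinate. *)
Require Import Defs.
From HB Require Import structures.
From mathcomp Require Import all_boot all_order all_algebra.
From mathcomp Require Import cyclic finfield.
From mathcomp Require Import ring zify.
Set Implicit Arguments. Unset Strict Implicit. Unset Printing Implicit Defensive.
Import GRing.Theory Num.Theory.
Local Open Scope ring_scope.

Lemma card_preim_inj (T : finType) (f : T -> T) (A : {pred T}) :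
  injective f -> #|[preim f of A]| = #|A|.
Proof.
move=> f_inj; rewrite card_preim //; apply: eq_card => x.
by rewrite !inE (injF_onto f_inj).
Qed.

(** * Euler's criterion and sums of a square and a nonsquare in a finite field of odd order *)

Section QuadraticCharacter.
Variables (F : finFieldType) (m : nat).
Hypothesis cardF : #|F| = m.*2.+1.

Lemma half_card_gt0 : (0 < m)%N.
Proof. by have := card_finNzRing_gt1 F; rewrite cardF; case: m. Qed.

Lemma expf_half_card_sqr (a : F) : a != 0 -> (a ^+ m) ^+ 2 = 1.
Proof.
move=> a0; apply: (mulfI a0); rewrite mulr1 -exprM muln2 -exprS -cardF.
exact: expf_card.
Qed.

(** The [2m] nonzero elements are all roots of [X^(2m) - 1], and that many distinct roots in a field
    include a primitive one. *)
Lemma ex_prim_root_card : exists z : F, (m.*2).-primitive_root z.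
Proof.
have m0 := half_card_gt0.
have /hasP[z _ zP] : has m.*2.-primitive_root (enum (predC1 (0 : F))).
  apply: has_prim_root; rewrite ?double_gt0 ?enum_uniq // -?cardE ?cardC1 ?cardF //.
  apply/allP=> a; rewrite mem_enum inE unity_rootE => a0.
  by rewrite -muln2 exprM expf_half_card_sqr.
by exists z.
Qed.

(** For a primitive root [z], the power [z ^+ m] squares to 1 but is not 1, because the order [2m]
    does not divide [m]. *)
Lemma ex_nonsquare : exists2 z : F, z ^+ m = -1 & (1 : F) != -1.
Proof.
have [z zP] := ex_prim_root_card; have m0 := half_card_gt0.
have z1 : z ^+ m != 1 by rewrite -(prim_order_dvd zP) gtnNdvd // -addnn -ltn_subLR ?subnn.
have z0 : z != 0.
  apply: contraNneq (oner_neq0 F) => z0.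
  by rewrite -(prim_expr_order zP) z0 expr0n double_eq0 (gtn_eqF m0).
have := expf_half_card_sqr z0 => /eqP; rewrite sqrf_eq1 (negPf z1) /= => /eqP zm.
by exists z; rewrite // eq_sym -zm.
Qed.

Lemma one_neqN1 : (1 : F) != -1. Proof. by case: ex_nonsquare. Qed.

Lemma expf_half_card (a : F) : a != 0 -> (a ^+ m == 1) || (a ^+ m == -1).
Proof. by move=> a0; rewrite -sqrf_eq1 expf_half_card_sqr. Qed.

Lemma euler_criterion (a : F) :
  (a ^+ m == 1) = (a != 0) && [exists b, b * b == a].
Proof.
have m0 := half_card_gt0.
have [->|a0] := eqVneq a 0.
  by rewrite expr0n (gtn_eqF m0) eq_sym oner_eq0.
apply/eqP/existsP => [am|[b /eqP ba]]; last first.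
  rewrite -ba -expr2 exprAC expf_half_card_sqr //.
  by apply: contraNneq a0 => b0; rewrite -ba b0 mul0r.
have [z zP] := ex_prim_root_card.
have [|[i /= _] ai] := prim_rootP zP (x := a); first by rewrite -muln2 exprM am expr1n.
(* With [a = z ^+ i], the hypothesis says that [2m] divides [i * m]; hence [i] is even and halving
   it gives the square root. *)
move/eqP: am; rewrite ai -exprM -(prim_order_dvd zP) -muln2 mulnC.
rewrite dvdn_pmul2r // => /dvdnP[j ij].
by exists (z ^+ j); rewrite -exprD addnn -muln2 -ij.
Qed.

Lemma euler_criterionN (a : F) :
  (a ^+ m == -1) = (a != 0) && ~~ [exists b, b * b == a].
Proof.
have [->|a0] := eqVneq a 0.
  by rewrite expr0n (gtn_eqF half_card_gt0) eq_sym oppr_eq0 oner_eq0.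
have := euler_criterion a; rewrite a0 /= => <-.
have /orP[/eqP->|/eqP->] := expf_half_card a0; first by rewrite eqxx (negPf one_neqN1).
by rewrite eqxx eq_sym one_neqN1.
Qed.

(** Multiplication by a nonsquare is a bijection between the two classes, which partition the [2m]
    nonzero elements. *)
Lemma card_expf_half_card (e : F) : (e == 1) || (e == -1) ->
  #|[pred a : F | a ^+ m == e]| = m.
Proof.
have m0 := half_card_gt0; have [n nm n1] := ex_nonsquare.
have n0 : n != 0.
  by apply: contra_eq_neq nm => ->; rewrite expr0n (gtn_eqF m0) eq_sym oppr_eq0 oner_eq0.
pose S e := [pred a : F | a ^+ m == e].
have eq : #|S 1| = #|S (-1)|.
  have n_inj : injective ( *%R n) by apply: mulfI.
  rewrite -(card_preim_inj (S (-1)) n_inj); apply: eq_card => a.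
  by rewrite !inE exprMn nm mulN1r eqr_opp.
have sum : (#|S 1%R| + #|S (-1)%R|)%N = m.*2.
  rewrite -cardUI [X in (_ + X)%N](_ : _ = 0)%N ?addn0; last first.
    by apply: eq_card0 => a; rewrite !inE; case: eqP => //= ->; rewrite (negPf n1).
  rewrite -[m.*2]/(m.*2.+1.-1) -cardF -(cardC1 (0 : F)); apply: eq_card => a; rewrite !inE.
  have [->|/expf_half_card] //= := eqVneq a 0.
  by rewrite expr0n (gtn_eqF m0) ![0 == _]eq_sym oppr_eq0 oner_eq0.
by rewrite -/(S e) => /orP[] /eqP->; lia.
Qed.

(* The coefficient of [X^k] in [Q * N]. *)
Definition reprs (k : F) : nat := #|[pred a : F | (a ^+ m == 1) && ((k - a) ^+ m == -1)]|.

Lemma reprs_const (k : F) : k != 0 -> reprs k = reprs 1.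
Proof.
move=> k0; rewrite /reprs.
have /orP[/eqP km|/eqP km] := expf_half_card k0.
  rewrite -(card_preim_inj _ (mulfI k0)); apply: eq_card => a.
  by rewrite !inE -[X in X - _]mulr1 -mulrBr !exprMn km !mul1r.
(* For a nonsquare [k], the decomposition [1 = a + (1 - a)] becomes [k = k * (1 - a) + k * a], in
   which the square and the nonsquare have traded places. *)
have f_inj : injective (fun a => k * (1 - a)).
  by move=> a b /(mulfI k0) /addrI /oppr_inj.
rewrite -(card_preim_inj _ f_inj); apply: eq_card => a; rewrite !inE.
have -> : k - k * (1 - a) = k * a by ring.
by rewrite !exprMn km !mulN1r eqr_opp eqr_oppLR andbC.
Qed.

(** The second summand is [- a], whose character is [(-1) ^+ m] times that of [a]: either every
    square contributes or none does. *)
Lemma reprs0 : reprs 0 = if odd m then m else 0%N.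
Proof.
rewrite /reprs; case: ifP => om.
  rewrite -[RHS](card_expf_half_card (e := 1)) ?eqxx //; apply: eq_card => a.
  by rewrite !inE sub0r exprNn -signr_odd om mulN1r eqr_opp andbb.
apply: eq_card0 => a; rewrite !inE sub0r exprNn -signr_odd om mul1r.
by case: eqP => // ->; rewrite (negPf one_neqN1).
Qed.
End QuadraticCharacter.

(** * Quadratic Gaussian periods and their product *)

Section PeriodProduct.
Variables (p m : nat).
Hypotheses (p_prime : prime p) (pE : p = m.*2.+1).

Lemma card_Fp_odd : #|'F_p| = m.*2.+1. Proof. by rewrite card_Fp. Qed.

Section Powers.
Variables (A : comNzRingType) (x : A).
Hypothesis xp1 : x ^+ p = 1.

(** For [e = 1] and [e = -1] these are the two Gaussian periods. The ring stays general so that [x]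
    can be the class of X as well as the integer 1. *)
Definition period (e : 'F_p) : A := \sum_(a : 'F_p | a ^+ m == e) x ^+ a.

Lemma expr_natFp n : x ^+ (n%:R : 'F_p) = x ^+ n.
Proof. by rewrite val_Fp_nat // expr_mod. Qed.

Lemma expr_addFp (a b : 'F_p) : x ^+ (a + b)%R = x ^+ a * x ^+ b.
Proof. by rewrite -[a in LHS]natr_Zp -[b in LHS]natr_Zp -natrD expr_natFp exprD. Qed.

Lemma period_mul :
  period 1 * period (-1) = \sum_(c : 'F_p) (reprs m c)%:R * x ^+ c.
Proof.
rewrite /period mulr_suml.
transitivity (\sum_(a : 'F_p | a ^+ m == 1) \sum_(c | (c - a) ^+ m == -1) x ^+ c).
  apply: eq_bigr => a _; rewrite mulr_sumr (reindex_inj (addIr (- a))).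
  by apply: eq_bigr => c _; rewrite -expr_addFp addrC subrK.
rewrite (exchange_big_dep xpredT) //=; apply: eq_bigr => c _.
by rewrite sumr_const mulr_natl.
Qed.

Lemma period_add : 1 + (period 1 + period (-1)) = \sum_(c : 'F_p) x ^+ c.
Proof.
rewrite (bigD1 0) //= expr0; congr (_ + _); rewrite /period.
rewrite [RHS](bigID (fun a : 'F_p => a ^+ m == 1)) /=; congr (_ + _); apply: eq_bigl => a.
  by rewrite (euler_criterion card_Fp_odd) andbA andbb.
rewrite (euler_criterionN card_Fp_odd) (euler_criterion card_Fp_odd).
by case: (a == 0).
Qed.

Lemma period_mulE :
  period 1 * period (-1) =
  (reprs m (0 : 'F_p))%:R + (reprs m (1 : 'F_p))%:R * (period 1 + period (-1)).
Proof.
rewrite period_mul; move: (reprs_const card_Fp_odd); move: (reprs m) => r rc.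
rewrite (bigD1 (0 : 'F_p)) //= mulr1; congr (_ + _).
have -> : period 1 + period (-1) = \sum_(c : 'F_p | c != 0) x ^+ c.
  by apply: (addrI 1); rewrite period_add (bigD1 0).
rewrite mulr_sumr; apply: eq_bigr => c c0.
by rewrite rc.
Qed.
End Powers.

Lemma period1 (A : comNzRingType) (e : 'F_p) : (e == 1) || (e == -1) ->
  period (1 : A) e = m%:R.
Proof.
move=> e1; rewrite /period (eq_bigr (fun=> 1)) => [|a _]; last by rewrite expr1n.
by rewrite sumr_const (card_expf_half_card card_Fp_odd e1).
Qed.

(** This is the product formula at [x = 1] over the integers, where both periods equal [m]; it
    determines the remaining constant. *)
Lemma reprs1 : (m * m = reprs m (0%R : 'F_p) + reprs m (1%R : 'F_p) * m.*2)%N.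
Proof.
have := period_mulE (expr1n int p); rewrite !period1 ?eqxx ?orbT // -natrD addnn.
by rewrite -!natrM -natrD => /eqP; rewrite eqr_nat => /eqP.
Qed.

End PeriodProduct.

(** * The algebra [K[X]/(X^p - 1)], its reversal and the Euclidean form *)

Section CyclicAlgebra.
Variables (K : comNzRingType) (p : nat).
Hypothesis p_gt0 : (0 < p)%N.
Local Notation A := {poly %/ ('X^p - 1 : {poly K})}.
Local Notation x := ('qX : A).
Implicit Types (f g : A) (w : 'I_p -> K).

Lemma coef_qpolyZ c f i : ((c *: f : A) : {poly K})`_i = c * (f : {poly K})`_i.
Proof. exact: coefZ. Qed.

(** The quotient construction replaces a modulus by ['X] unless it is monic and nonconstant; [p > 0]
    excludes this default. *)
Lemma mk_monic_Xn_sub_1 : mk_monic ('X^p - 1 : {poly K}) = 'X^p - 1.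
Proof. by rewrite /mk_monic -polyC1 size_XnsubC // ltnS p_gt0 monicXnsubC. Qed.

Lemma size_mk_monic_Xn_sub_1 : size (mk_monic ('X^p - 1 : {poly K})) = p.+1.
Proof. by rewrite mk_monic_Xn_sub_1 -polyC1 size_XnsubC. Qed.

Lemma qX_expr_order : x ^+ p = 1.
Proof.
apply/eqP; rewrite -subr_eq0 -rmorphXn -(in_qpoly1 ('X^p - 1)) -rmorphB /=.
apply/eqP/val_inj; rewrite /= mk_monic_Xn_sub_1.
by rewrite Pdiv.RingMonic.rmodpp // -polyC1 monicXnsubC.
Qed.

Lemma coef_qX_expr i j : (j < p)%N ->
  ((x ^+ i : A) : {poly K})`_j = (i %% p == j)%N%:R.
Proof.
move=> jp; rewrite -(expr_mod i qX_expr_order) -rmorphXn /= Pdiv.CommonRing.rmodp_small.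
  by rewrite coefXn eq_sym.
by rewrite size_mk_monic_Xn_sub_1 size_polyXn !ltnS ltn_mod.
Qed.

Lemma coef_qX_sum w (j : 'I_p) :
  ((\sum_(i < p) w i *: x ^+ i : A) : {poly K})`_j = w j.
Proof.
rewrite poly_of_qpoly_sum coef_sum (bigD1 j) //= big1 => [|i ij].
  by rewrite coefZ coef_qX_expr // modn_small // eqxx mulr1 addr0.
by rewrite coefZ coef_qX_expr // modn_small // (negPf (ij : i != j :> nat)) mulr0.
Qed.

Lemma qpoly_sum_coef g : g = \sum_(i < p) (g : {poly K})`_i *: x ^+ i.
Proof.
apply/val_inj/polyP => j; have [jp|pj] := ltnP j p.
  by rewrite -[j]/(val (Ordinal jp)) coef_qX_sum.
rewrite !(big_coef_npoly (n := (size (mk_monic ('X^p - 1 : {poly K}))).-1)) //;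
  by rewrite size_mk_monic_Xn_sub_1.
Qed.

(** Since [x ^+ p = 1], the power [x ^+ p.-1] is the inverse of [x], so this substitutes [X^(-1)]
    for [X]. *)
Definition qrev g : A := \sum_(i < p) (g : {poly K})`_i *: (x ^+ p.-1) ^+ i.

Lemma qrev_linear : linear qrev.
Proof.
move=> a f g; rewrite /qrev scaler_sumr -big_split; apply: eq_bigr => i _.
by rewrite coefD coefZ scalerDl scalerA.
Qed.
HB.instance Definition _ := GRing.isLinear.Build K A A _ qrev qrev_linear.

Lemma qrev_qX_expr i : qrev (x ^+ i) = (x ^+ p.-1) ^+ i.
Proof.
have ip : (i %% p < p)%N by rewrite ltn_mod.
rewrite /qrev (bigD1 (Ordinal ip)) //= big1 => [|j ji].
  rewrite coef_qX_expr // eqxx scale1r addr0 expr_mod //.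
  by rewrite -exprM mulnC exprM qX_expr_order expr1n.
by rewrite coef_qX_expr // eq_sym (negPf (ji : j != i %% p :> nat)%N) scale0r.
Qed.

Lemma qrevM : {morph qrev : f g / f * g}.
Proof.
move=> f g; rewrite [f]qpoly_sum_coef [g]qpoly_sum_coef mulr_suml !raddf_sum mulr_suml.
apply: eq_bigr => i _; rewrite !mulr_sumr !raddf_sum; apply: eq_bigr => j _ /=.
by rewrite -scalerAl -scalerAr -exprD !linearZ /= !qrev_qX_expr -scalerAl -scalerAr -exprD.
Qed.

Definition dot f g : K := \sum_(i < p) (f : {poly K})`_i * (g : {poly K})`_i.

(** On monomials, [x ^+ i] times the inverse of [x ^+ j] has constant coefficient 1 if [i = j] and 0
    otherwise. *)
Lemma dotE f g : dot f g = ((f * qrev g : A) : {poly K})`_0.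
Proof.
rewrite [f in RHS]qpoly_sum_coef mulr_suml poly_of_qpoly_sum coef_sum.
apply: eq_bigr => i _; rewrite /qrev mulr_sumr poly_of_qpoly_sum coef_sum.
rewrite (bigD1 i) // big1 => [|j ji];
  rewrite -scalerAl -scalerAr !coef_qpolyZ -exprM -exprD coef_qX_expr //.
  by rewrite -mulSn prednK // modnMr eqxx mulr1 /= addr0.
suff /negPf-> : ((i + p.-1 * j) %% p != 0)%N by rewrite !mulr0.
apply: contra ji; rewrite /= -/(p %| _)%N => pd; apply/eqP/val_inj => /=.
rewrite -(modn_small (ltn_ord i)) -(modn_small (ltn_ord j)).
(* Adding [j] to an exponent divisible by [p] shows that [j] and [i] agree modulo [p]. *)
have : (j + (i + p.-1 * j) = i + p * j)%N by rewrite addnCA -mulSn prednK.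
by move/(congr1 (modn^~ p)); rewrite -modnDmr (eqP pd) addn0 addnC [(p * _)%N]mulnC modnMDl.
Qed.

(** Taking [a = x ^+ k] shifts [f * qrev g] by [-k], so its constant coefficient reads off the
    [k]-th one of [f * qrev g]. *)
Lemma dot_ideal_eq0 f g : (forall a, dot f (a * g) = 0) <-> f * qrev g = 0.
Proof.
split => [H|fg a]; last by rewrite dotE qrevM mulrCA fg mulr0 coef0.
rewrite (qpoly_sum_coef (f * qrev g)); apply: big1 => k _.
have := H (x ^+ k); rewrite dotE qrevM qrev_qX_expr mulrCA.
set h := f * _; rewrite {1}[h]qpoly_sum_coef mulr_sumr poly_of_qpoly_sum coef_sum.
rewrite (bigD1 k) // big1 => [|j jk];
  rewrite -scalerAr coef_qpolyZ -exprM -exprD coef_qX_expr //.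
  by rewrite addnC -mulSn prednK // modnMr eqxx mulr1 /= addr0 => ->; rewrite scale0r.
suff /negPf-> : ((p.-1 * k + j) %% p != 0)%N by rewrite !mulr0.
apply: contra jk; rewrite /= -/(p %| _)%N => pd; apply/eqP/val_inj => /=.
rewrite -(modn_small (ltn_ord k)) -(modn_small (ltn_ord j)).
have : (k + (p.-1 * k + j) = j + p * k)%N by rewrite addnA -mulSn prednK // addnC.
by move/(congr1 (modn^~ p)); rewrite -modnDmr (eqP pd) addn0 addnC [(p * _)%N]mulnC modnMDl.
Qed.

Definition all_ones : A := \sum_(i < p) x ^+ i.

Lemma coef_all_ones (i : 'I_p) : (all_ones : {poly K})`_i = 1.
Proof.
rewrite /all_ones; under eq_bigr => j _ do rewrite -[x ^+ j]scale1r.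
by rewrite (coef_qX_sum (fun=> 1)).
Qed.

Lemma mul_qX_all_ones i : x ^+ i * all_ones = all_ones.
Proof.
elim: i => [|i IHi]; first by rewrite expr0 mul1r.
rewrite exprSr -mulrA -[RHS]IHi; congr (_ * _); rewrite /all_ones mulr_sumr.
case: p qX_expr_order => [|n] xp; first by rewrite !big_ord0.
(* Multiplication by [x] shifts the powers cyclically: the last term becomes [x ^+ p = 1], the first
   one of the sum. *)
rewrite big_ord_recr big_ord_recl /= -exprS xp addrC expr0; congr (_ + _).
by apply: eq_bigr => j _; rewrite -exprS.
Qed.

Lemma mul_all_ones g : g * all_ones = (\sum_(i < p) (g : {poly K})`_i) *: all_ones.
Proof.
rewrite {1}[g]qpoly_sum_coef mulr_suml scaler_suml; apply: eq_bigr => i _.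
by rewrite -scalerAl mul_qX_all_ones.
Qed.

End CyclicAlgebra.

(** * Codewords and duals of extended codes *)

Section ExtendedCodes.
Variable p : nat.
Hypothesis p_gt0 : (0 < p)%N.
Implicit Types (e f g : Rp p).
Local Notation J := (all_ones Rv p : Rp p).

(** Codewords are described by the multiplier [u] of the first row and an element of the ideal,
    which removes the choice of [G]. *)
Lemma ext_codeP k (G : 'M[Rv]_(k, p)) e x y (c : 'rV[Rv]_(1 + p)) :
  is_generator_matrix (cyclic_code e) G ->
  ext_code x y G c <->
  exists u : Rv, exists a : Rp p, c 0 (lshift p 0) = u * x /\
    forall i, c 0 (rshift 1 i) = u * y + (a * e : {poly Rv})`_i.
Proof.
move=> hG; split=> [[u ->]|[u [a [c0 cS]]]].
  have [|a aE] := (hG (rsubmx u *m G)).2; first by exists (rsubmx u).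
  exists (u 0 (lshift k 0)), a; rewrite -[u in u *m _]hsubmxK mul_row_col mul_mx_row mulmx0 aE.
  split=> [|i]; first by rewrite mxE row_mxEl !mxE big_ord1 !mxE /= addr0.
  by rewrite mxE row_mxEr !mxE big_ord1 !mxE.
have [|t tE] := (hG (vec_of (a * e))).1; first by exists a.
exists (row_mx (u%:M) t); rewrite mul_row_col mul_mx_row mulmx0 -tE.
apply/rowP => j; case: (split_ordP j) => i ->.
  by rewrite ord1 c0 mxE row_mxEl mul_scalar_mx !mxE /= addr0.
by rewrite cS mxE row_mxEr mul_scalar_mx !mxE.
Qed.

(** One statement serves both residue classes. Annihilating [J] makes ideal words have coordinate
    sum 0, hence orthogonal to constant words; [x * x' + p%:R * (y * y') = 0] says that the two
    first rows are orthogonal. *)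
Lemma dual_ext_code k k' (G : 'M[Rv]_(k, p)) (G' : 'M[Rv]_(k', p)) e e' (d x y x' y' : Rv) :
  is_generator_matrix (cyclic_code e) G ->
  is_generator_matrix (cyclic_code e') G' ->
  e' * qrev e = 0 -> 1 = qrev e + e' + d *: J -> e * J = 0 -> e' * J = 0 ->
  x * x' + p%:R * (y * y') = 0 -> x * x = 1 -> y' * y' = 1 ->
  code_eq (dual (ext_code x y G)) (ext_code x' y' G').
Proof.
move=> hG hG' e'e one_eq eJ e'J xy xx yy w.
have sumJ g : g * J = 0 -> \sum_(i < p) (g : {poly Rv})`_i = 0.
  rewrite mul_all_ones // => /(congr1 (fun h : Rp p => (h : {poly Rv})`_0)).
  by rewrite coef_qpolyZ (coef_all_ones _ p_gt0 (Ordinal p_gt0)) mulr1 coef0.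
have dotD (u u' : Rv) (h h' : Rp p) : h * J = 0 -> h' * J = 0 ->
    \sum_(i < p) (u + (h : {poly Rv})`_i) * (u' + (h' : {poly Rv})`_i) =
    p%:R * (u * u') + dot h h'.
  move=> hJ h'J; under eq_bigr do rewrite mulrDl !mulrDr.
  rewrite !big_split /= sumr_const card_ord -mulr_sumr -mulr_suml !sumJ //.
  by rewrite mulr0 mul0r /= addr0 add0r mulr_natl.
have mulJ a h : h * J = 0 -> a * h * J = 0 by move=> hJ; rewrite -mulrA hJ mulr0.
rewrite (ext_codeP _ _ _ hG'); split=> [wd|[u' [a' [w0 wS]]] c]; last first.
  case/(ext_codeP _ _ _ hG) => u [a [c0 cS]].
  rewrite big_split_ord big_ord1 /= w0 c0.
  under eq_bigr do rewrite wS cS.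
  rewrite dotD ?mulJ //.
  have -> : dot (a' * e') (a * e) = 0.
    by apply: (@dot_ideal_eq0 _ _ p_gt0 (a' * e') e).2; rewrite -mulrA e'e mulr0.
  rewrite addr0 -[RHS](mulr0 (u' * u)) -xy; ring.
pose f : Rp p := \sum_(i < p) w 0 (rshift 1 i) *: 'qX ^+ i.
have fE (i : 'I_p) : w 0 (rshift 1 i) = (f : {poly Rv})`_i by rewrite coef_qX_sum.
pose s := \sum_(i < p) (f : {poly Rv})`_i.
(* Orthogonality of [w], with tail [f] of coordinate sum [s], to an arbitrary codeword. *)
have wd' u a : w 0 (lshift p 0) * (u * x) + (s * (u * y) + dot f (a * e)) = 0.
  pose c : 'rV[Rv]_(1 + p) := \row_j (match split j with
    inl _ => u * x | inr i => u * y + (a * e : {poly Rv})`_i end).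
  have c0 : c 0 (lshift p 0) = u * x by rewrite mxE (unsplitK (inl _ 0)).
  have cS i : c 0 (rshift 1 i) = u * y + (a * e : {poly Rv})`_i.
    by rewrite mxE (unsplitK (inr _ i)).
  have /wd : ext_code x y G c by apply/(ext_codeP _ _ _ hG); exists u, a.
  rewrite big_split_ord big_ord1 /= c0 => wc; rewrite -[RHS]wc; congr (_ + _).
  rewrite /s /dot mulr_suml -big_split; apply: eq_bigr => i _ /=.
  by rewrite cS fE mulrDr.
(* The codewords with [u = 0] make [f] orthogonal to the whole ideal of [e]. *)
have fe : f * qrev e = 0.
  apply: (@dot_ideal_eq0 _ _ p_gt0 f e).1 => a.
  by have := wd' 0 a; rewrite !mul0r !mulr0 !add0r.
have fJ : f * J = s *: J by rewrite mul_all_ones.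
have f_eq : f = f * e' + (d * s) *: J.
  by rewrite -[LHS]mulr1 one_eq !mulrDr fe add0r -scalerAr fJ scalerA.
have f_coef i : (i < p)%N -> (f : {poly Rv})`_i = d * s + (f * e' : {poly Rv})`_i.
  move=> ip; rewrite {1}f_eq poly_of_qpolyD coefD coef_qpolyZ.
  by rewrite (coef_all_ones _ p_gt0 (Ordinal ip)) mulr1; apply: addrC.
(* Summing the coefficients of [f]: the part in the ideal of [e'] contributes 0. *)
have sE : s = d * s * p%:R.
  rewrite {1}/s; under eq_bigr => i _ do rewrite f_coef //.
  by rewrite big_split sumJ ?mulJ // sumr_const card_ord mulr_natr /= addr0.
(* Here [w] is tested against the first row alone. *)
have w0x : w 0 (lshift p 0) * x + s * y = 0.
  have := wd' 1 0; rewrite !mul1r mul0r /dot [X in _ + (_ + X)]big1 ?addr0 //.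
  by move=> i _; rewrite coef0 mulr0.
(* The multiplier [u'] must satisfy [u' * y' = d * s], and [y'] is its own inverse. *)
exists (d * s * y'), f; split=> [|i].
  (* Multiply the orthogonality of the first rows by [x * y'], using [x * x = 1] and
     [y' * y' = 1]. *)
  have x'y' : x' * y' = - (p%:R * (x * y)).
    have -> : x' * y' = x * (x * x' + p%:R * (y * y')) * y' - (x * x - 1) * (x' * y')
      - p%:R * (x * y) * (y' * y' - 1) - p%:R * (x * y) by ring.
    by rewrite xy xx yy; ring.
  have -> : w 0 (lshift p 0) = x * (w 0 (lshift p 0) * x + s * y)
    - (x * x - 1) * w 0 (lshift p 0) - s * (x * y) by ring.
  have -> : s * (x * y) = d * s * p%:R * (x * y) by rewrite -sE.
  have -> : d * s * y' * x' = d * s * (x' * y') by ring.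
  by rewrite w0x xx x'y'; ring.
by rewrite fE f_coef // -mulrA yy mulr1.
Qed.
End ExtendedCodes.

(** * Quadratic residues as elements of ['F_p], with [Qp] and [Np] as periods *)

Lemma big_Fp (A : nmodType) p (P : pred nat) (f : nat -> A) : prime p ->
  \sum_(a : 'F_p | P a) f a = \sum_(i < p | P i) f i.
Proof. by move=> p_pr; rewrite -(big_mkord P f) -(big_mkord P f) Fp_cast. Qed.

Lemma ltn_Fp p (a : 'F_p) : prime p -> (a < p)%N.
Proof. by move=> p_pr; rewrite -[X in (_ < X)%N](Fp_cast p_pr). Qed.

Lemma exists_sqr_Fp p (a : 'F_p) : prime p ->
  [exists b : 'F_p, b * b == a] = [exists j : 'I_p, ((j * j) %% p == a)%N].
Proof.
move=> p_pr; apply/existsP/existsP => [[b /eqP <-]|[j /eqP ja]].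
  have -> : b * b = (b * b)%N%:R by rewrite natrM natr_Zp.
  by exists (Ordinal (ltn_Fp b p_pr)); rewrite val_Fp_nat.
exists (j%:R); rewrite -natrM; apply/eqP/val_inj.
exact: etrans (val_Fp_nat p_pr _) ja.
Qed.

Section QRPeriods.
Variables (p m : nat).
Hypotheses (p_prime : prime p) (pE : p = m.*2.+1).

Lemma Qp_period : Qp p = period m ('qX : Rp p) (1 : 'F_p).
Proof.
rewrite /Qp -(big_Fp (is_qr p) (fun i => 'qX ^+ i)) //; apply: eq_bigl => a.
rewrite (euler_criterion (card_Fp_odd p_prime pE)) exists_sqr_Fp // /is_qr.
by rewrite ltn_Fp // lt0n.
Qed.

Lemma Np_period : Np p = period m ('qX : Rp p) (-1 : 'F_p).
Proof.
rewrite /Np -(big_Fp (is_nqr p) (fun i => 'qX ^+ i)) //; apply: eq_bigl => a.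
rewrite (euler_criterionN (card_Fp_odd p_prime pE)) exists_sqr_Fp // /is_nqr.
by rewrite ltn_Fp // lt0n.
Qed.

Let p_gt0 : (0 < p)%N. Proof. exact: prime_gt0. Qed.
Local Notation J := (all_ones Rv p : Rp p).
Let xp1 := qX_expr_order Rv p_gt0.

Lemma all_ones_Qp_Np : J = 1 + (Qp p + Np p).
Proof.
rewrite Qp_period Np_period (period_add p_prime pE) /all_ones.
by rewrite (big_Fp xpredT (fun i => ('qX : Rp p) ^+ i)).
Qed.

Lemma period_mul_all_ones (e : 'F_p) : (e == 1) || (e == -1) ->
  period m ('qX : Rp p) e * J = m%:R * J.
Proof.
move=> e1; rewrite /period mulr_suml (eq_bigr (fun=> J)) => [|a _];
  last exact: mul_qX_all_ones.
by rewrite sumr_const (card_expf_half_card (card_Fp_odd p_prime pE) e1) mulr_natl.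
Qed.

(** Reversal negates exponents, and [(- a) ^+ m = (-1) ^+ m * a ^+ m], so the parity of [m] decides
    whether the periods are swapped. *)
Lemma qrev_period (e : 'F_p) :
  qrev (period m ('qX : Rp p) e) = period m ('qX : Rp p) ((-1) ^+ m * e).
Proof.
rewrite /period raddf_sum (reindex_inj oppr_inj); apply: eq_big => a.
  by rewrite (exprNn a); apply/eqP/eqP => [<-|->]; rewrite signrMK.
have N1E : -1 = p.-1%:R :> 'F_p.
  by apply: (addIr 1); rewrite addNr natr1 prednK // pchar_Fp_0.
move=> _; rewrite /= (qrev_qX_expr _ p_gt0) -exprM -[LHS](expr_natFp p_prime xp1).
have -> // : (p.-1 * (- a)%R)%N%:R = a :> 'F_p.
by rewrite natrM -N1E mulN1r natr_Zp opprK.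
Qed.

End QRPeriods.

(** * Complementary annihilating pairs in a ring where 4 vanishes *)

Section ComplementaryPairs.
Variable A : comNzRingType.
Hypothesis four0 : 4%:R = 0 :> A.

Lemma natr_mod4 n : n%:R = (n %% 4)%:R :> A.
Proof. by rewrite {1}(divn_eq n 4) natrD natrM four0 mulr0 add0r. Qed.

(** The idempotent [V] splits the ring in two; the pair is [(s, t)] on one factor and [(t, s)] on
    the other, and the relations are symmetric in [s] and [t]. *)
Lemma combine_pair (V s t J d : A) : V * V = V -> s * t = 0 -> 1 = s + t + d * J ->
    s * J = 0 -> t * J = 0 ->
  let e1 := V * s + (1 - V) * t in let e2 := V * t + (1 - V) * s in
  [/\ e1 * e2 = 0, 1 = e1 + e2 + d * J, e1 * J = 0 & e2 * J = 0].
Proof.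
move=> VV st one_eq sJ tJ e1 e2; split.
- have -> : e1 * e2 = s * t * (V * V + (1 - V) * (1 - V)) + (V - V * V) * (s * s + t * t).
    by rewrite /e1 /e2; ring.
  by rewrite st VV subrr !mul0r addr0.
- by rewrite {1}one_eq /e1 /e2; ring.
- have -> : e1 * J = V * (s * J) + (1 - V) * (t * J) by rewrite /e1; ring.
  by rewrite sJ tJ !mulr0 addr0.
- have -> : e2 * J = V * (t * J) + (1 - V) * (s * J) by rewrite /e2; ring.
  by rewrite sJ tJ !mulr0 addr0.
Qed.

Variables (Q N J : A) (m c0 c1 : nat).
Hypotheses (J_eq : J = 1 + (Q + N)) (QJ : Q * J = m%:R * J) (NJ : N * J = m%:R * J)
  (QN : Q * N = c0%:R + c1%:R * (Q + N)).

Lemma pair_3mod4_odd : (m %% 4 = 3)%N -> (c0 %% 4 = 3)%N -> (c1 %% 4 = 1)%N ->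
  let s := 1 - N + 2%:R * Q in let t := 1 - Q + 2%:R * N in
  [/\ s * t = 0, 1 = s + t + (-1) * J, s * J = 0 & t * J = 0].
Proof.
move=> m3 c03 c11 s t; move: QJ NJ QN.
rewrite (natr_mod4 m) (natr_mod4 c0) (natr_mod4 c1) m3 c03 c11 => QJ3 NJ3 QN1.
split; last 2 first.
- have -> : s * J = J - N * J + 2%:R * (Q * J) by rewrite /s; ring.
  by rewrite QJ3 NJ3 -[RHS](mul0r J) -four0; ring.
- have -> : t * J = J - Q * J + 2%:R * (N * J) by rewrite /t; ring.
  by rewrite QJ3 NJ3 -[RHS](mul0r J) -four0; ring.
(* Each group on the right vanishes by one of the known products, and the last one because 4
   does. *)
- have -> : s * t = Q * N - (3%:R + 1%:R * (Q + N)) - 2%:R * (Q * J - 3%:R * J)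
      - 2%:R * (N * J - 3%:R * J) + 4%:R * (1 + Q + N - 3%:R * J + 2%:R * (Q * N)).
    by rewrite /s /t J_eq; ring.
  by rewrite QN1 QJ3 NJ3 !subrr four0; ring.
- by rewrite /s /t J_eq; ring.
Qed.

Lemma pair_3mod4_even : (m %% 4 = 3)%N -> (c0 %% 4 = 3)%N -> (c1 %% 4 = 3)%N ->
  let s := 1 + N in let t := 1 + Q in
  [/\ s * t = 0, 1 = s + t + (-1) * J, s * J = 0 & t * J = 0].
Proof.
move=> m3 c03 c13 s t; move: QJ NJ QN.
rewrite (natr_mod4 m) (natr_mod4 c0) (natr_mod4 c1) m3 c03 c13 => QJ3 NJ3 QN3.
split; last 2 first.
- by rewrite /s mulrDl NJ3 -[RHS](mul0r J) -four0; ring.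
- by rewrite /t mulrDl QJ3 -[RHS](mul0r J) -four0; ring.
- have -> : s * t = 1 + Q + N + Q * N by rewrite /s /t; ring.
  by rewrite QN3 -[RHS](mul0r (1 + Q + N)) -four0; ring.
- by rewrite /s /t J_eq; ring.
Qed.

Lemma pair_0mod4_odd : (m %% 4 = 0)%N -> (c0 %% 4 = 0)%N -> (c1 %% 4 = 2)%N ->
  let s := Q + 2%:R * N in let t := N + 2%:R * Q in
  [/\ s * t = 0, 1 = s + t + 1 * J, s * J = 0 & t * J = 0].
Proof.
move=> m0 c00 c12 s t; move: QJ NJ QN.
rewrite (natr_mod4 m) (natr_mod4 c0) (natr_mod4 c1) m0 c00 c12 !mul0r add0r => QJ0 NJ0 QN2.
split; last 2 first.
- by rewrite /s mulrDl -mulrA QJ0 NJ0 mulr0 addr0.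
- by rewrite /t mulrDl -mulrA QJ0 NJ0 mulr0 addr0.
- have -> : s * t = Q * N - 2%:R * (Q + N) + 2%:R * (Q * J + N * J).
    by rewrite /s /t J_eq; ring.
  by rewrite QN2 QJ0 NJ0 subrr addr0 mulr0 addr0.
(* Here [s + t + J] exceeds 1 by exactly [4 * (Q + N)]. *)
- rewrite -[LHS]addr0 -(mul0r (Q + N)) -four0 /s /t J_eq; ring.
Qed.

Lemma pair_0mod4_even : (m %% 4 = 0)%N -> (c0 %% 4 = 0)%N -> (c1 %% 4 = 0)%N ->
  [/\ - Q * - N = 0, 1 = - Q + - N + 1 * J, - Q * J = 0 & - N * J = 0].
Proof.
move=> m0 c00 c10; move: QJ NJ QN.
rewrite (natr_mod4 m) (natr_mod4 c0) (natr_mod4 c1) m0 c00 c10 !mul0r addr0 => QJ0 NJ0 QN0.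
by rewrite mulrNN !mulNr QN0 QJ0 NJ0 oppr0; split=> //; rewrite J_eq; ring.
Qed.
End ComplementaryPairs.

(** * Arithmetic of the coefficient ring and the counting constants modulo 4 *)

Lemma four_eq0_Rv : 4%:R = 0 :> Rv.
Proof.
rewrite -(rmorph_nat (qpolyC ('X^2 - 'X : {poly 'Z_4}))).
rewrite -[RHS](rmorph0 (qpolyC ('X^2 - 'X : {poly 'Z_4}))).
by congr qpolyC; apply: val_inj.
Qed.

Lemma vR_idem : vR * vR = vR.
Proof.
have /monicP hm : 'X^2 - 'X \is @monic 'Z_4.
  by rewrite monicE lead_coefDl ?lead_coefXn // size_polyN size_polyX size_polyXn.
have sz : size ('X^2 - 'X : {poly 'Z_4}) = 3%N.
  by rewrite size_polyDl ?size_polyN ?size_polyX size_polyXn.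
apply/eqP; rewrite -subr_eq0 -expr2 /vR /qpolyX -rmorphXn -rmorphB /=.
apply/eqP/val_inj => /=; rewrite /mk_monic sz /= monicE hm eqxx.
by rewrite Pdiv.RingMonic.rmodpp // monicE hm.
Qed.

Lemma four_eq0_Rp p : 4%:R = 0 :> Rp p.
Proof. by rewrite -(scaler_nat 4) four_eq0_Rv scale0r. Qed.

Section Generators.
Variable p : nat.
Hypothesis p_prime : prime p.

(** Turning the scalar action into multiplication by an idempotent gives the form required by
    [combine_pair]. *)
Lemma scale_vR (g h : Rp p) : vR *: g + (1 - vR) *: h = vR%:A * g + (1 - vR%:A) * h.
Proof. by rewrite mulrBl mul1r !mulr_algl scalerBl scale1r. Qed.

Lemma vR_alg_idem : vR%:A * vR%:A = vR%:A :> Rp p.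
Proof. by rewrite mulr_algl scalerA vR_idem. Qed.

(** With [p = 8r - 1], one has [m = 4r - 1] and [reprs m 0 = m]; cancelling [m] in the count leaves
    [reprs m 1 = (m - 1) / 2 = 2r - 1]. *)
Lemma QR_constants_7 : (p %% 8 = 7)%N -> let m := p./2 in
  [/\ p = m.*2.+1, (m %% 4 = 3)%N, odd m, (reprs m (0%R : 'F_p) %% 4 = 3)%N
   & (reprs m (1%R : 'F_p) %% 4 = if odd ((p + 1) %/ 8) then 1 else 3)%N].
Proof.
move=> p7 m; have pE : p = m.*2.+1 by rewrite /m; lia.
have m3 : (m %% 4 = 3)%N by lia.
have om : odd m by lia.
have m_gt0 := half_card_gt0 (card_Fp_odd p_prime pE).
have := reprs1 p_prime pE; rewrite (reprs0 (card_Fp_odd p_prime pE)) om.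
move: (reprs m _) => c mm.
have c1 : m = (1 + 2 * c)%N.
  by apply/eqP; rewrite -(eqn_pmul2l m_gt0) mm -mul2n; apply/eqP; ring.
by split=> //; case: ifP => odd_r; lia.
Qed.

(** With [p = 8r + 1], one has [m = 4r] and [reprs m 0 = 0], so the count leaves
    [reprs m 1 = m / 2 = 2r]. *)
Lemma QR_constants_1 : (p %% 8 = 1)%N -> let m := p./2 in
  [/\ p = m.*2.+1, (m %% 4 = 0)%N, odd m = false, reprs m (0%R : 'F_p) = 0%N
   & (reprs m (1%R : 'F_p) %% 4 = if odd ((p - 1) %/ 8) then 2 else 0)%N].
Proof.
move=> p1 m; have pE : p = m.*2.+1 by rewrite /m; lia.
have m0 : (m %% 4 = 0)%N by lia.
have om : odd m = false by lia.
have m_gt0 := half_card_gt0 (card_Fp_odd p_prime pE).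
have := reprs1 p_prime pE; rewrite (reprs0 (card_Fp_odd p_prime pE)) om.
move: (reprs m _) => c mm.
have c1 : m = (2 * c)%N.
  by apply/eqP; rewrite -(eqn_pmul2l m_gt0) mm -mul2n; apply/eqP; ring.
by split=> //; case: ifP => odd_r; lia.
Qed.
End Generators.

(** * Relations between the two generators and their behaviour under reversal *)

Section GeneratorPairs.
Variable p : nat.
Hypothesis p_prime : prime p.
Local Notation J := (all_ones Rv p : Rp p).
Let m := p./2.

Lemma Qp_Np_relations : p = m.*2.+1 ->
  [/\ J = 1 + (Qp p + Np p), Qp p * J = m%:R * J, Np p * J = m%:R * J
    & Qp p * Np p = (reprs m (0 : 'F_p))%:R + (reprs m (1 : 'F_p))%:R * (Qp p + Np p)].
Proof.
move=> pE; split.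
- exact: all_ones_Qp_Np p_prime pE.
- by rewrite (Qp_period p_prime pE) (period_mul_all_ones p_prime pE) ?eqxx.
- by rewrite (Np_period p_prime pE) (period_mul_all_ones p_prime pE) ?eqxx ?orbT.
rewrite (Qp_period p_prime pE) (Np_period p_prime pE).
have xp1 : ('qX : Rp p) ^+ p = 1 := qX_expr_order Rv (prime_gt0 p_prime).
have QN := @period_mulE p m p_prime pE (Rp p) _ xp1; exact: QN.
Qed.

Lemma E12_complementary_7 : (p %% 8 = 7)%N ->
  [/\ E1gen p * E2gen p = 0, 1 = E1gen p + E2gen p + (-1) *: J, E1gen p * J = 0
    & E2gen p * J = 0].
Proof.
move=> p7; have [pE m3 om c03 c1E] := QR_constants_7 p_prime p7.
have [JE QJ NJ QN] := Qp_Np_relations pE.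
have four0 := four_eq0_Rp p; have VV := vR_alg_idem p.
have -> : (-1 : Rv) *: J = -1 * J by rewrite scaleN1r mulN1r.
rewrite /E1gen /E2gen p7 [(7 == 7)%N]eqxx.
move: (Qp p) (Np p) JE QJ NJ QN => Q N JE QJ NJ QN.
rewrite !scale_vR; move: c1E; case: ifP => _ c1E.
  have [st one_eq sJ tJ] := pair_3mod4_odd four0 JE QJ NJ QN m3 c03 c1E.
  exact: combine_pair VV st one_eq sJ tJ.
have [st one_eq sJ tJ] := pair_3mod4_even four0 JE QJ NJ QN m3 c03 c1E.
exact: combine_pair VV st one_eq sJ tJ.
Qed.

Lemma E12_complementary_1 : (p %% 8 = 1)%N ->
  [/\ E1gen p * E2gen p = 0, 1 = E1gen p + E2gen p + 1 *: J, E1gen p * J = 0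
    & E2gen p * J = 0].
Proof.
move=> p1; have [pE m0 om c00 c1E] := QR_constants_1 p_prime p1.
have [JE QJ NJ QN] := Qp_Np_relations pE.
have four0 := four_eq0_Rp p; have VV := vR_alg_idem p.
have c00' : (reprs m (0%R : 'F_p) %% 4 = 0)%N by rewrite c00.
have -> : (1 : Rv) *: J = 1 * J by rewrite scale1r mul1r.
rewrite /E1gen /E2gen p1 [(1 == 7)%N]/=.
move: (Qp p) (Np p) JE QJ NJ QN => Q N JE QJ NJ QN.
move: c1E; case: ifP => _ c1E.
  have [st one_eq sJ tJ] := pair_0mod4_odd four0 JE QJ NJ QN m0 c00' c1E.
  by rewrite !scale_vR; exact: combine_pair VV st one_eq sJ tJ.
have [st one_eq sJ tJ] := pair_0mod4_even four0 JE QJ NJ QN m0 c00' c1E.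
(* For even [r] the generators are the combinations of the pair [- Q], [- N]. *)
have neg_comb (f g : Rp p) :
    - (vR *: f) - (1 - vR) *: g = vR%:A * - f + (1 - vR%:A) * - g.
  by rewrite -scale_vR !scalerN.
by rewrite !neg_comb; exact: combine_pair VV st one_eq sJ tJ.
Qed.

Lemma qrev_Qp_Np : p = m.*2.+1 ->
  if odd m then qrev (Qp p) = Np p /\ qrev (Np p) = Qp p
  else qrev (Qp p) = Qp p /\ qrev (Np p) = Np p.
Proof.
move=> pE; rewrite (Qp_period p_prime pE) (Np_period p_prime pE) !qrev_period //.
by rewrite -signr_odd; case: odd; rewrite /= ?expr1 ?expr0 ?mul1r ?mulN1r ?opprK.
Qed.

(* Specialised to [Rp p]: the generic lemmas make unification unfold the two
   nested quotients. *)
Lemma qrevD (f g : Rp p) : qrev (f + g) = qrev f + qrev g.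
Proof. exact: raddfD. Qed.

Lemma qrevN (f : Rp p) : qrev (- f) = - qrev f.
Proof. exact: raddfN. Qed.

Lemma qrevZ (a : Rv) (f : Rp p) : qrev (a *: f) = a *: qrev f.
Proof. exact: linearZ. Qed.

Lemma qrev1 : qrev (1 : Rp p) = 1.
Proof. by have := qrev_qX_expr Rv (prime_gt0 p_prime) 0; rewrite !expr0. Qed.

Lemma qrev_mul2 (f : Rp p) : qrev (2%:R * f) = 2%:R * qrev f.
Proof. by rewrite !mulr_natl; apply: raddfMn. Qed.

Lemma qrev_E12_7 : (p %% 8 = 7)%N -> qrev (E1gen p) = E2gen p /\ qrev (E2gen p) = E1gen p.
Proof.
move=> p7; have [pE _ om _ _] := QR_constants_7 p_prime p7.
have := qrev_Qp_Np pE; rewrite om => -[qQ qN].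
rewrite /E1gen /E2gen p7 [(7 == 7)%N]eqxx.
move: (Qp p) (Np p) qQ qN => Q N qQ qN.
case: ifP => _; rewrite !qrevD !qrevZ !qrevD ?qrevN ?qrev_mul2;
  by rewrite qQ qN qrev1.
Qed.

Lemma qrev_E12_1 : (p %% 8 = 1)%N -> qrev (E1gen p) = E1gen p /\ qrev (E2gen p) = E2gen p.
Proof.
move=> p1; have [pE _ om _ _] := QR_constants_1 p_prime p1.
have := qrev_Qp_Np pE; rewrite om => -[qQ qN].
rewrite /E1gen /E2gen p1 [(1 == 7)%N]/=.
move: (Qp p) (Np p) qQ qN => Q N qQ qN.
case: ifP => _; rewrite !qrevD.
  by rewrite !qrevZ !qrevD !qrev_mul2 qQ qN.
by rewrite !qrevN !qrevZ qQ qN.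
Qed.
End GeneratorPairs.

Theorem theorem20 (p : nat) (hp : prime p) (hp8 : (p %% 8 == 1)%N || (p %% 8 == 7)%N)
  (k1 k2 : nat) (G1 : 'M[Rv]_(k1, p)) (G2 : 'M[Rv]_(k2, p))
  (hG1 : is_generator_matrix (cyclic_code (E1gen p)) G1)
  (hG2 : is_generator_matrix (cyclic_code (E2gen p)) G2) :
  ((p %% 8 == 7)%N ->
     [/\ self_dual (ext_code 3 3 G1), self_dual (ext_code 3 3 G2),
         self_dual (ext_code 1 3 G1) & self_dual (ext_code 1 3 G2)]) /\
  ((p %% 8 == 1)%N ->
     code_eq (dual (ext_code 3 1 G1)) (ext_code 1 1 G2) /\
     code_eq (dual (ext_code 3 1 G2)) (ext_code 1 1 G1)).
Proof.
have p_gt0 := prime_gt0 hp.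
have natr0 n : (n %% 4 = 0)%N -> n%:R = 0 :> Rv.
  by move=> n4; rewrite (natr_mod4 four_eq0_Rv) n4.
have sq1 : 1 * 1 = 1 :> Rv by rewrite mulr1.
have sq3 : 3%:R * 3%:R = 1 :> Rv.
  by rewrite -natrM (natr_mod4 four_eq0_Rv).
split=> /eqP p8.
  have [e12 one_eq e1J e2J] := E12_complementary_7 hp p8.
  (* Reversal swaps the generators, so each code is paired with itself. *)
  have [q1 q2] := qrev_E12_7 hp p8.
  have e11 : E1gen p * qrev (E1gen p) = 0 by rewrite q1.
  have e22 : E2gen p * qrev (E2gen p) = 0 by rewrite q2 mulrC.
  have one1 : 1 = qrev (E1gen p) + E1gen p + (-1) *: all_ones Rv p.
    by rewrite q1 [E2gen p + _]addrC.
  have one2 : 1 = qrev (E2gen p) + E2gen p + (-1) *: all_ones Rv p by rewrite q2.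
  (* Both 3 and 1 square to 1 modulo 4, and 4 divides [p + 1]; this covers both extensions. *)
  have p3 (x : Rv) : x * x = 1 -> x * x + p%:R * (3%:R * 3%:R) = 0.
    have p1 : 1 + p%:R = 0 :> Rv by rewrite nat1r natr0 //; lia.
    by move=> ->; rewrite sq3 mulr1.
  split.
  - exact: (dual_ext_code p_gt0 hG1 hG1 e11 one1 e1J e1J (p3 _ sq3) sq3 sq3).
  - exact: (dual_ext_code p_gt0 hG2 hG2 e22 one2 e2J e2J (p3 _ sq3) sq3 sq3).
  - exact: (dual_ext_code p_gt0 hG1 hG1 e11 one1 e1J e1J (p3 _ sq1) sq1 sq3).
  - exact: (dual_ext_code p_gt0 hG2 hG2 e22 one2 e2J e2J (p3 _ sq1) sq1 sq3).
have [e12 one_eq e1J e2J] := E12_complementary_1 hp p8.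
(* Reversal now fixes the generators, so each code is paired with the other one. *)
have [q1 q2] := qrev_E12_1 hp p8.
have p31 : 3%:R * 1 + p%:R * (1 * 1) = 0 :> Rv.
  by rewrite !mulr1 -natrD natr0 //; lia.
have e21 : E2gen p * qrev (E1gen p) = 0 by rewrite q1 mulrC.
have e12' : E1gen p * qrev (E2gen p) = 0 by rewrite q2.
have one1 : 1 = qrev (E1gen p) + E2gen p + 1 *: all_ones Rv p by rewrite q1.
have one2 : 1 = qrev (E2gen p) + E1gen p + 1 *: all_ones Rv p.
  by rewrite q2 [E2gen p + _]addrC.
split.
- exact: (dual_ext_code p_gt0 hG1 hG2 e21 one1 e1J e2J p31 sq3 sq1).
- exact: (dual_ext_code p_gt0 hG2 hG1 e12' one2 e2J e1J p31 sq3 sq1).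
Qed.
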